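(* Let $\rho\in\{z\in\mathbb{C}:|z|<1\}$, $x\in(0,\infty)$, and let $a,b,c,d,h\in\mathbb{C}$ satisfy $\Re a,\Re b,\Re c,\Re d,\Re h>0$, with the non-real parameters among $a,b,c,d,h$ occurring in conjugate pairs. Then $${}_2F_1\!\left(\begin{array}{c}a+ix,\ b+ix\\ a+b\end{array};\rho\right)\,{}_2F_1\!\left(\begin{array}{c}c-ix,\ d-ix\\ c+d\end{array};\rho\right)=\sum_{k=0}^\infty\frac{(k+a+b+c+d-1)_k}{(k+a+b+c+h-1)_k\,(a+b)_k\,(c+d)_k\,k!}$$ $$\times\,{}_4F_3\!\left(\begin{array}{c}d-h,\ 2k+a+b+c+d-1,\ k+a+c,\ k+b+c\\ k+a+b+c+d-1,\ 2k+a+b+c+h,\ k+c+d\end{array};\rho\right)\rho^k\,W_k\!\left(x^2;a,b,c,h\right).$$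
   Context: $(z)_n:=\prod_{i=1}^n(z+i-1)$ is the Pochhammer symbol. ${}_pF_q(a_1,\dots,a_p;b_1,\dots,b_q;z):=\sum_{n=0}^\infty\frac{(a_1)_n\cdots(a_p)_n}{(b_1)_n\cdots(b_q)_n}\frac{z^n}{n!}$. The Wilson polynomials are, for $n\in\mathbb{N}_0=\{0,1,2,\dots\}$, $$W_n(x^2;a,b,c,d):=(a+b)_n(a+c)_n(a+d)_n\;{}_4F_3\!\left(\begin{array}{c}-n,\ n+a+b+c+d-1,\ a+ix,\ a-ix\\ a+b,\ a+c,\ a+d\end{array};1\right).$$ In the $k=0$ term of the expansion, the equal upper and lower parameters $a+b+c+d-1$ of the ${}_4F_3$ are understood to cancel (this matters only if $a+b+c+d=1$). *)

(* Defs.v *)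
From HB Require Import structures.
From mathcomp Require Export all_boot all_order all_algebra.
From mathcomp Require Export all_classical all_reals all_analysis.
From mathcomp Require Export complex.

Set Implicit Arguments.
Unset Strict Implicit.
Unset Printing Implicit Defensive.

Export Order.TTheory GRing.Theory Num.Theory.
Export numFieldNormedType.Exports.

Local Open Scope classical_set_scope.
Local Open Scope ring_scope.
Local Open Scope complex_scope.

Definition pochhammer (R : realType) (z : R[i]) (n : nat) : R[i] :=
  \prod_(1 <= m < n.+1) (z + m%:R - 1).

(* In MathComp [x / 0 = 0], so a term with a vanishing lower Pochhammer symbol
   is [0] rather than undefined. *)
Definition pFq_term (R : realType) (upper lower : seq R[i]) (z : R[i])
    (n : nat) : R[i] :=
  (\prod_(p <- upper) pochhammer p n) / (\prod_(q <- lower) pochhammer q n)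
  * (z ^+ n / n`!%:R).

(* [R[i]^o] is [R[i]] with the topology given by its modulus; where the series
   diverges, [limn] returns an unspecified value. *)
Definition pFq (R : realType) (upper lower : seq R[i]) (z : R[i]) : R[i] :=
  limn (series (pFq_term upper lower z : nat -> R[i]^o)).

(* [wilson n x a b c d] is W_n(x^2; a, b, c, d): the polynomial variable is the
   square of the argument [x]. *)
Definition wilson (R : realType) (n : nat) (x : R) (a b c d : R[i]) : R[i] :=
  pochhammer (a + b) n * pochhammer (a + c) n * pochhammer (a + d) n *
  pFq [:: - n%:R; n%:R + a + b + c + d - 1; a + 'i%C * x%:C; a - 'i%C * x%:C]
      [:: a + b; a + c; a + d] 1.

(* Main.v *)
Require Import Defs.
From mathcomp Require Import all_boot all_order all_algebra.
From mathcomp Require Import all_classical all_reals all_analysis.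
From mathcomp Require Import complex.
From mathcomp Require Import ring lra zify.

(** Everything rests on one polynomial identity, the Pfaff-Saalschutz
    summation [saalschutz], valid in any commutative ring.  Write X for ix and
    s_e for a + b + c + e.

    Used twice, it gives Whipple's transformation [whipple]: the coefficient of
    rho^n in the product of the two 2F1 series is
    W_n(x^2; a, b, c, d) / ((a+b)_n (c+d)_n n!).

    Used once more, it connects the Wilson polynomials of parameter d to those
    of parameter h.  W_n is a combination of the products (a+X)_j (a-X)_j with
    triangular coefficients A(d).  Saalschutz computes the product A(d) B(h) for
    an explicit triangular B(h); the answer [connection_coef] is the identity
    when d = h because it contains (d-h)_{n-k}.  Hence B(h) inverts A(h), and
    A(d) = (A(d) B(h)) A(h) is the connection formula [wilson_connection].

    Substituting, the product of the 2F1 series is the sum over n of the sums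
    over k <= n of a double family [double_term k (n - k)], while for fixed k
    the sum over m of [double_term k m] is the k-th term of the expansion: its
    m-dependence is exactly that of the 4F3.

    What remains is to sum by rows instead of by diagonals.  Up to a factor
    polynomial in n + k, the modulus of (z+n)_k is at most (n+k)!/n! for every z
    ([rising_upper]), and at least that when Re z > 0 ([rising_lower]).  In
    [double_term] these factorials cancel completely, so that it is
    O(poly(k+m) |rho|^(k+m)), hence O(q^(k+m)) for some q < 1.  Under such a
    bound, the partial sums of order N by rows and by diagonals differ by
    O(N q^N) ([series_rows_diagonals]).  The same lemma gives the Cauchy product
    of the two 2F1 series. *)

Set Implicit Arguments.
Unset Strict Implicit.
Local Open Scope classical_set_scope.
Local Open Scope ring_scope.
Local Open Scope complex_scope.

Local Notation normc := ComplexField.Normc.normc.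

(** * Rearranging finite sums *)

Lemma sum_triangle (V : nmodType) (N : nat) (F : nat -> nat -> V) :
  \sum_(j < N) \sum_(k < j.+1) F j k = \sum_(k < N) \sum_(i < N - k) F (k + i)%N k.
Proof.
elim: N => [|N IHN]; first by rewrite !big_ord0.
rewrite big_ord_recr /= IHN [RHS]big_ord_recr /= subSnn big_ord1 addn0.
rewrite [X in _ + X]big_ord_recr /= addrA; congr (_ + _).
rewrite -big_split /=; apply: eq_bigr => k _.
by rewrite subSn ?(ltnW (ltn_ord k)) // big_ord_recr /= subnKC // ltnW.
Qed.

Lemma sum_pascal (R : comNzRingType) (n : nat) (g : nat -> R) :
  \sum_(m < n.+2) 'C(n.+1, m)%:R * g m
  = \sum_(m < n.+1) 'C(n, m)%:R * (g m + g m.+1).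
Proof.
rewrite big_ord_recl /= bin0.
under eq_bigr => m _ do rewrite binS natrD mulrDl.
rewrite big_split /= addrA.
under [RHS]eq_bigr => m _ do rewrite mulrDr.
rewrite [RHS]big_split /=; congr (_ + _).
rewrite big_ord_recr /= bin_small // mul0r addr0.
by rewrite [RHS]big_ord_recl /= bin0.
Qed.

Lemma bin_subset_of_subset n k m : (k + m <= n)%N ->
  ('C(n, k + m) * 'C(k + m, k) = 'C(n, k) * 'C(n - k, m))%N.
Proof.
move=> le_kmn.
have le_kn : (k <= n)%N by lia.
have le_mn : (m <= n - k)%N by lia.
have fact_pos : (0 < k`! * m`! * (n - k - m)`!)%N by rewrite !muln_gt0 !fact_gt0.
apply/eqP; rewrite -(eqn_pmul2r fact_pos); apply/eqP.
have := bin_fact le_kmn; have := bin_fact (leq_addr m k).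
have := bin_fact le_kn; have := bin_fact le_mn.
rewrite (_ : k + m - k = m)%N ?subnDA; last by lia.
nia.
Qed.

Lemma sum_window (V : nmodType) (N k n : nat) (F : nat -> V) : (k <= n < N)%N ->
  (forall j, (j < k)%N -> F j = 0) -> (forall j, (n < j)%N -> F j = 0) ->
  \sum_(j < N) F j = \sum_(i < (n - k).+1) F (k + i)%N.
Proof.
move=> /andP[le_kn lt_nN] F0l F0r.
rewrite -(big_mkord xpredT F) (big_cat_nat (n := k)) //=; last by lia.
rewrite (big_cat_nat (n := n.+1) (m := k)) //=; last by lia.
have -> : \sum_(0 <= j < k) F j = 0.
  by rewrite big_nat; apply: big1 => j /andP[_ /F0l].
have -> : \sum_(n.+1 <= j < N) F j = 0.
  by rewrite big_nat; apply: big1 => j /andP[/F0r].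
rewrite add0r addr0 -{1}[k]add0n big_addn subSn // big_mkord.
by apply: eq_bigr => i _; rewrite addnC.
Qed.

(** * Rising factorials, Saalschutz and Whipple *)

Section Rising.
Variable R : comNzRingType.
Implicit Types (z p q D : R).

Definition rising z n := \prod_(i < n) (z + i%:R).

Lemma rising0 z : rising z 0 = 1.
Proof. exact: big_ord0. Qed.

Lemma risingSr z n : rising z n.+1 = rising z n * (z + n%:R).
Proof. exact: big_ord_recr. Qed.

Lemma risingD z m n : rising z (m + n) = rising z m * rising (z + m%:R) n.
Proof.
elim: n => [|n IHn]; first by rewrite addn0 rising0 mulr1.
by rewrite addnS !risingSr IHn natrD addrA mulrA.
Qed.

Lemma risingS z n : rising z n.+1 = z * rising (z + 1) n.
Proof. by rewrite -(add1n n) risingD risingSr rising0 mul1r addr0. Qed.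

Lemma rising_0l n : rising 0 n = (n == 0%N)%:R.
Proof. by case: n => [|n]; rewrite ?rising0 // risingS mul0r. Qed.

(** Reversing the order of the factors. *)
Lemma rising_reflect z n : rising (1 - z - n%:R) n = (-1) ^+ n * rising z n.
Proof.
elim: n z => [|n IHn] z; first by rewrite !rising0 mulr1.
rewrite risingSr [rising z _]risingS exprS.
have -> : 1 - z - n.+1%:R = 1 - (z + 1) - n%:R by rewrite -natr1; ring.
by rewrite IHn; ring.
Qed.

(** Pfaff-Saalschutz, in a denominator-free form.  By Pascal's rule, the sum of
    order n + 1 is (D-p)(D-q) T + n (D+n) S, where S is the sum of order n and T
    the same sum with D + m replaced by D + 1 + m but the factor (D-p-q)_{n-m}
    unchanged.  The difference T - S is a multiple of the sum of order n - 1 at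
    D + 1, whence a strong induction in which D varies. *)
Lemma saalschutz n p q D :
  \sum_(m < n.+1) 'C(n, m)%:R *
    (rising p m * rising q m * rising (D + m%:R) (n - m)
     * rising (D - p - q) (n - m))
  = rising (D - p) n * rising (D - q) n.
Proof.
elim/ltn_ind: n D => -[|n] IH D.
  by rewrite big_ord1 !rising0 bin0 !mulr1.
set e := D - p - q.
rewrite (sum_pascal n (fun m => rising p m * rising q m
  * rising (D + m%:R) (n.+1 - m) * rising e (n.+1 - m))).
(* The summands of S and T. *)
pose S m := rising p m * rising q m * rising (D + m%:R) (n - m) * rising e (n - m).
pose T m := rising p m * rising q m * rising (D + 1 + m%:R) (n - m) * rising e (n - m).
have ST (m : nat) : (m <= n)%N ->
    rising p m * rising q m * rising (D + m%:R) (n.+1 - m) * rising e (n.+1 - m)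
    + rising p m.+1 * rising q m.+1 * rising (D + m.+1%:R) (n.+1 - m.+1)
      * rising e (n.+1 - m.+1)
  = (D - p) * (D - q) * T m + n%:R * (D + n%:R) * S m.
  move=> le_mn.
  have [l nE] : exists l, n = (m + l)%N by exists (n - m)%N; rewrite subnKC.
  have -> : (n.+1 - m)%N = l.+1 by rewrite nE; lia.
  rewrite subSS /T /S (_ : (n - m)%N = l); last by rewrite nE; lia.
  have H : (D + m%:R) * rising (D + 1 + m%:R) l
           = rising (D + m%:R) l * (D + n%:R).
    rewrite -addrA [1 + _]addrC addrA -risingS risingSr nE natrD; ring.
  rewrite [rising (D + m%:R) l.+1]risingS !risingSr -natr1.
  rewrite (_ : D + (m%:R + 1) = D + 1 + m%:R); last by ring.
  rewrite (_ : D + m%:R + 1 = D + 1 + m%:R); last by ring.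
  rewrite [n%:R * _ * _](_ : _ = n%:R * (rising p m * rising q m * rising e l
    * (rising (D + m%:R) l * (D + n%:R)))); last by ring.
  rewrite -H nE natrD /e; ring.
rewrite [LHS](_ : _ = (D - p) * (D - q) * (\sum_(m < n.+1) 'C(n, m)%:R * T m)
   + n%:R * (D + n%:R) * (\sum_(m < n.+1) 'C(n, m)%:R * S m)); last first.
  rewrite !mulr_sumr -big_split /=; apply: eq_bigr => m _.
  rewrite ST ?leq_ord //; ring.
have SE : \sum_(m < n.+1) 'C(n, m)%:R * S m = rising (D - p) n * rising (D - q) n.
  exact: IH.
have dTS : (D - p) * (D - q) * (\sum_(m < n.+1) 'C(n, m)%:R * T m
      - \sum_(m < n.+1) 'C(n, m)%:R * S m)
    = n%:R * e * (rising (D - p) n * rising (D - q) n).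
  rewrite -sumrB.
  rewrite /S /T; clear S T ST SE; case: n IH => [|n] IH.
    by rewrite big_ord1 !rising0 subrr mulr0 !mul0r.
  rewrite big_ord_recr /= subnn !rising0 -mulrBr subrr mulr0 addr0.
  have TS (m : nat) : (m <= n)%N ->
     'C(n.+1, m)%:R * (rising p m * rising q m
         * rising (D + 1 + m%:R) (n.+1 - m) * rising e (n.+1 - m))
     - 'C(n.+1, m)%:R * (rising p m * rising q m
         * rising (D + m%:R) (n.+1 - m) * rising e (n.+1 - m))
     = n.+1%:R * e * ('C(n, m)%:R * (rising p m * rising q m *
        rising (D + 1 + m%:R) (n - m) * rising (D + 1 - p - q) (n - m))).
    move=> le_mn; have := mul_bin_down n.+1 m => /(congr1 (fun k => k%:R : R)) /=.
    rewrite !natrM subSn //; set l := (n - m)%N => binE.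
    rewrite [rising (D + m%:R) _]risingS risingSr risingS.
    rewrite [in RHS](_ : n.+1%:R * e * _ = (n.+1%:R * 'C(n, m)%:R) * (e *
        (rising p m * rising q m * rising (D + 1 + m%:R) l
         * rising (D + 1 - p - q) l))); last by ring.
    rewrite binE (_ : D + m%:R + 1 = D + 1 + m%:R); last by ring.
    rewrite (_ : D + 1 - p - q = e + 1); last by rewrite /e; ring.
    by rewrite -natr1; ring.
  rewrite (eq_bigr _ (fun m _ => TS _ (leq_ord m))) -mulr_sumr IH //.
  rewrite !risingS (_ : D + 1 - p = D - p + 1); last by ring.
  rewrite (_ : D + 1 - q = D - q + 1); last by ring.
  ring.
move: dTS; rewrite SE mulrBr => /eqP; rewrite subr_eq => /eqP ->.
rewrite !risingSr /e; ring.
Qed.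

(** The Wilson polynomial with its denominators cleared: (a+b)_n / (a+b)_k is
    written (a+b+k)_{n-k}, and (-n)_k / k! is (-1)^k times a binomial, which
    makes sense in every commutative ring. *)
Definition wilson_coef n k a b c d : R :=
  'C(n, k)%:R * (-1) ^+ k *
    (rising (n%:R + a + b + c + d - 1) k * rising (a + b + k%:R) (n - k)
     * rising (a + c + k%:R) (n - k) * rising (a + d + k%:R) (n - k)).

Definition wilson_poly n X a b c d : R :=
  \sum_(k < n.+1) wilson_coef n k a b c d * (rising (a + X) k * rising (a - X) k).

(** Whipple's transformation of a terminating balanced 4F3.  Reading
    (c+d+n-j)_j as (-1)^j (1-c-d-n)_j, Saalschutz with D = a + b expands
    (b+X)_j (1-c-d-n)_j over the products (a-X)_k (n+s_d-1)_k; after exchanging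
    the sums, the sum over j is again of Saalschutz type. *)
Lemma whipple n X a b c d :
  \sum_(j < n.+1) 'C(n, j)%:R *
    (rising (a + X) j * rising (b + X) j * rising (a + b + j%:R) (n - j)
     * (rising (c - X) (n - j) * rising (d - X) (n - j)
        * rising (c + d + (n - j)%:R) j))
  = wilson_poly n X a b c d.
Proof.
(* The parameter that makes (c+d+n-j)_j a rising factorial of length j with a
   base independent of j. *)
pose C := 1 - (c + d) - n%:R.
pose F j k := 'C(n, j)%:R * 'C(j, k)%:R * (-1) ^+ j *
  (rising (a + X) j * rising (a + b + k%:R) (n - k) * rising (c - X) (n - j)
   * rising (d - X) (n - j) * rising (a - X) k
   * rising (n%:R + a + b + c + d - 1) k * rising (b + X + C - (a + b)) (j - k)).
transitivity (\sum_(j < n.+1) \sum_(k < j.+1) F j k).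
  apply: eq_bigr => j _; have le_jn : (j <= n)%N by rewrite leq_ord.
  have CE : rising (c + d + (n - j)%:R) j = (-1) ^+ j * rising C j.
    rewrite (_ : C = 1 - (c + d + (n - j)%:R) - j%:R) ?rising_reflect ?signrMK //.
    by rewrite /C natrB //; ring.
  have := saalschutz j (a - X) (n%:R + a + b + c + d - 1) (a + b).
  rewrite (_ : a + b - (a - X) = b + X); last by ring.
  rewrite (_ : a + b - (n%:R + a + b + c + d - 1) = C); last by rewrite /C; ring.
  rewrite (_ : b + X - _ = b + X + C - (a + b)); last by rewrite /C; ring.
  move=> sE.
  rewrite CE [LHS](_ : _ = 'C(n, j)%:R * (-1) ^+ j * (rising (a + X) j
     * rising (a + b + j%:R) (n - j) * rising (c - X) (n - j)
     * rising (d - X) (n - j)) * (rising (b + X) j * rising C j)); last by ring.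
  rewrite -sE mulr_sumr; apply: eq_bigr => k _.
  have le_kj : (k <= j)%N by rewrite leq_ord.
  rewrite /F (_ : (n - k)%N = ((j - k) + (n - j))%N); last by lia.
  rewrite risingD -[a + b + k%:R + _]addrA -natrD subnKC //; ring.
rewrite sum_triangle /wilson_poly /wilson_coef; apply: eq_bigr => k _.
have le_kn : (k <= n)%N by rewrite leq_ord.
rewrite subSn //; set N := (n - k)%N.
have := saalschutz N (c - X) (d - X) (a + c + d - X + k%:R).
rewrite (_ : _ - (c - X) = a + d + k%:R); last by ring.
rewrite (_ : a + c + d - X + k%:R - (d - X) = a + c + k%:R); last by ring.
rewrite (_ : a + d + k%:R - (d - X) = a + X + k%:R); last by ring.
move=> sE.
rewrite [RHS](_ : _ = 'C(n, k)%:R * (-1) ^+ k * (rising (a + X) k * rising (a - X) k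
  * rising (n%:R + a + b + c + d - 1) k * rising (a + b + k%:R) N)
  * (rising (a + d + k%:R) N * rising (a + c + k%:R) N)); last by ring.
rewrite -sE (reindex_inj rev_ord_inj) /= mulr_sumr; apply: eq_bigr => i _.
have le_iN : (i <= N)%N by rewrite leq_ord.
rewrite subSS /F.
have mE : (i + (N - i) = N)%N by rewrite subnKC.
have NE : (k + N = n)%N by rewrite subnKC.
set m := (N - i)%N in mE *; clearbody m N.
rewrite (_ : (n - k)%N = N); last by lia.
rewrite (_ : (n - (k + m))%N = i); last by lia.
rewrite (_ : (k + m - k)%N = m); last by lia.
rewrite risingD -mulrA.
have binE : ('C(n, k + m) * 'C(k + m, k) = 'C(n, k) * 'C(N, i))%N.
  rewrite bin_subset_of_subset; last by lia.
  rewrite -(bin_sub le_iN) (_ : n - k = N)%N; last by lia.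
  by rewrite (_ : m = N - i)%N //; lia.
have -> : rising (b + X + C - (a + b)) m
   = (-1) ^+ m * rising (a + c + d - X + k%:R + i%:R) m.
  rewrite -rising_reflect; congr rising.
  rewrite /C (_ : n%:R = k%:R + (i%:R + m%:R)); [ring | by rewrite -!natrD mE NE].
have sgE : (-1) ^+ (k + m) * (-1) ^+ m = (-1) ^+ k :> R.
  by rewrite exprD -mulrA -expr2 sqrr_sign mulr1.
have {}binE : 'C(n, k + m)%:R * 'C(k + m, k)%:R = 'C(n, k)%:R * 'C(N, i)%:R :> R.
  by rewrite -!natrM binE.
rewrite binE -sgE; ring.
Qed.
End Rising.

(** * The connection formula for Wilson polynomials *)

Section Connection.
Variables (F : fieldType) (a b c h : F).
Hypothesis abch_neq0 : forall m : nat, a + b + c + h + m%:R != 0.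

Lemma rising_neq0 (z : F) n : (forall m : nat, z + m%:R != 0) -> rising z n != 0.
Proof. by move=> z_neq0; apply/prodf_neq0 => i _. Qed.

Lemma rising_abch_neq0 m n : rising (m%:R + a + b + c + h) n != 0.
Proof.
apply: rising_neq0 => i; rewrite (_ : _ + _ = a + b + c + h + (m + i)%:R) //.
by rewrite natrD; ring.
Qed.

Lemma rising_abch_pred_neq0 k : rising (k%:R + a + b + c + h - 1) k != 0.
Proof.
case: k => [|k]; first by rewrite rising0 oner_neq0.
rewrite (_ : _ - 1 = k%:R + a + b + c + h) ?rising_abch_neq0 //.
by rewrite -natr1; ring.
Qed.

(** The inverse of the triangular matrix [wilson_coef] at parameter h: the
    products (a+X)_j (a-X)_j expand over the Wilson polynomials with these
    coefficients. *)
Definition wilson_inv_coef j k : F :=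
  'C(j, k)%:R * (-1) ^+ k *
    (rising (a + b + k%:R) (j - k) * rising (a + c + k%:R) (j - k)
     * rising (a + h + k%:R) (j - k))
  / (rising (k%:R + a + b + c + h - 1) k
     * rising ((2 * k)%:R + a + b + c + h) (j - k)).

Definition connection_coef n k d : F :=
  'C(n, k)%:R *
    (rising (n%:R + a + b + c + d - 1) k * rising (d - h) (n - k)
     * (rising (a + b + k%:R) (n - k) * rising (a + c + k%:R) (n - k)
        * rising (b + c + k%:R) (n - k)))
  / (rising (k%:R + a + b + c + h - 1) k
     * rising ((2 * k)%:R + a + b + c + h) (n - k)).

(** With j = k + i, the sum over i is the Saalschutz sum with
    p = n+k+s_d-1, q = a+h+k and D = a+d+k, for which D - q = d - h. *)
Lemma sum_wilson_coef_inv N n k d : (n < N)%N ->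
  \sum_(j < N) wilson_coef n j a b c d * wilson_inv_coef j k
  = connection_coef n k d.
Proof.
move=> lt_nN; case: (leqP k n) => [le_kn|lt_nk]; last first.
  rewrite /connection_coef bin_small // !mul0r; apply: big1 => j _.
  rewrite /wilson_coef /wilson_inv_coef.
  case: (leqP j n) => [le_jn|/bin_small ->]; last by rewrite !mul0r.
  by rewrite ['C(j, k)]bin_small ?mul0r ?mulr0 //; lia.
rewrite (sum_window (k := k) (n := n)
  (F := fun j => wilson_coef n j a b c d * wilson_inv_coef j k)) ?le_kn //.
- have := saalschutz (n - k) ((n + k)%:R + a + b + c + d - 1) (a + h + k%:R)
    (a + d + k%:R).
  have [N' nE] : exists N', n = (k + N')%N by exists (n - k)%N; lia.
  rewrite (_ : n - k = N')%N; last by lia.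
  rewrite (_ : a + d + k%:R - (a + h + k%:R) = d - h); last by ring.
  rewrite (_ : a + d + k%:R - _ = 1 - (b + c + k%:R) - N'%:R); last first.
    by rewrite nE !natrD; ring.
  rewrite rising_reflect => sE.
  rewrite /connection_coef (_ : n - k = N')%N; last by lia.
  rewrite [RHS](_ : _ = 'C(n, k)%:R * (-1) ^+ N' *
    (rising (n%:R + a + b + c + d - 1) k * (rising (a + b + k%:R) N'
      * rising (a + c + k%:R) N'))
    / (rising (k%:R + a + b + c + h - 1) k
       * rising ((2 * k)%:R + a + b + c + h) N') *
    ((-1) ^+ N' * rising (b + c + k%:R) N' * rising (d - h) N')); last first.
    have sq : (-1) ^+ N' * (-1) ^+ N' = 1 :> F by rewrite -expr2 sqrr_sign.
    by rewrite -[LHS]mul1r -[X in X * _ = _]sq; ring.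
  rewrite -sE mulr_sumr; apply: eq_bigr => i _.
  move: (nat_of_ord i) (leq_ord i) => {}i le_iN.
  rewrite /wilson_coef /wilson_inv_coef.
  rewrite (_ : k + i - k = i)%N; last by lia.
  rewrite (_ : n - (k + i) = N' - i)%N; last by lia.
  have binE : 'C(n, k + i)%:R * 'C(k + i, k)%:R = 'C(n, k)%:R * 'C(N', i)%:R :> F.
    rewrite -!natrM bin_subset_of_subset; last by lia.
    by rewrite (_ : n - k = N')%N //; lia.
  have [l NE] : exists l, N' = (i + l)%N by exists (N' - i)%N; lia.
  have lE : (N' - i = l)%N by lia.
  rewrite lE.
  rewrite [rising _ (k + i)]risingD.
  have risingN z : rising z N' = rising z i * rising (z + i%:R) l.
    by rewrite -risingD -NE.
  rewrite !risingN.
  rewrite (_ : 1 - (b + c + k%:R) - N'%:R - (a + h + k%:R)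
     = 1 - ((2 * k)%:R + a + b + c + h + i%:R) - l%:R); last first.
    by rewrite NE natrM natrD; ring.
  rewrite rising_reflect.
  rewrite (_ : n%:R + a + b + c + d - 1 + k%:R = (n + k)%:R + a + b + c + d - 1);
    last by rewrite natrD; ring.
  rewrite [(k + i)%:R]natrD !(addrA _ k%:R i%:R).
  have ne1 := rising_abch_pred_neq0 k.
  have ne2 := rising_abch_neq0 (2 * k) i.
  have ne3 : rising ((2 * k)%:R + a + b + c + h + i%:R) l != 0.
    rewrite (_ : _ + i%:R = (2 * k + i)%:R + a + b + c + h) ?rising_abch_neq0 //.
    by rewrite natrD; ring.
  have sgE : (-1) ^+ (k + i) * (-1) ^+ k = (-1) ^+ N' * (-1) ^+ l :> F.
    rewrite exprD mulrAC -expr2 sqrr_sign mul1r NE exprD -mulrA -expr2 sqrr_sign.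
    by rewrite mulr1.
  move: ne1 ne2 ne3 sgE binE.
  move: (rising (_ - 1) _) (rising (_ + h) i) (rising (_ + h + i%:R) l).
  move=> u v w u0 v0 w0.
  move: ((-1) ^+ (k + i)) ((-1) ^+ k) ((-1) ^+ N') ((-1) ^+ l) => s1 s2 s3 s4 sgE.
  move: ('C(n, k + i)%:R) ('C(k + i, k)%:R) ('C(n, k)%:R) ('C(N', i)%:R).
  move=> b1 b2 b3 b4 binE.
  rewrite [LHS](_ : _ = b1 * b2 * (s1 * s2) *
    (rising (n%:R + a + b + c + d - 1) k *
   rising ((n + k)%:R + a + b + c + d - 1) i * rising (a + b + k%:R + i%:R) l *
   rising (a + c + k%:R + i%:R) l * rising (a + d + k%:R + i%:R) l *
   (rising (a + b + k%:R) i * rising (a + c + k%:R) i *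
    rising (a + h + k%:R) i)) / (u * v)); last by ring.
  rewrite binE sgE; field.
  by rewrite u0 v0 w0.
- by move=> j lt_jk; rewrite /wilson_inv_coef bin_small // !mul0r mulr0.
- by move=> j lt_nj; rewrite /wilson_coef bin_small // !mul0r.
Qed.

Lemma connection_coef_id n k : connection_coef n k h = (n == k)%:R.
Proof.
rewrite /connection_coef subrr rising_0l.
have [->|ne_nk] := eqVneq n k.
  rewrite subnn !rising0 binn !(mulr1, mul1r) divff //.
  exact: rising_abch_pred_neq0.
case: (ltnP n k) => [lt_nk|le_kn]; first by rewrite bin_small // !mul0r.
by rewrite (_ : n - k == 0 = false)%N ?(mulr0, mul0r) //; lia.
Qed.

(** The previous lemmas make [wilson_inv_coef] a right inverse; for square
    matrices it is then also a left inverse, which is what the expansion of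
    (a+X)_j (a-X)_j requires. *)
Lemma sum_inv_wilson_coef N j i : (j < N)%N -> (i < N)%N ->
  \sum_(k < N) wilson_inv_coef j k * wilson_coef k i a b c h = (j == i)%:R.
Proof.
move=> lt_jN lt_iN.
pose A := \matrix_(n < N, k < N) wilson_coef n k a b c h.
pose B := \matrix_(n < N, k < N) wilson_inv_coef n k.
have /mulmx1C/matrixP/(_ (Ordinal lt_jN) (Ordinal lt_iN)) : A *m B = 1%:M.
  apply/matrixP => n k; rewrite !mxE.
  under eq_bigr do rewrite !mxE.
  by rewrite sum_wilson_coef_inv // connection_coef_id.
rewrite !mxE => <-.
by apply: eq_bigr => k _; rewrite !mxE.
Qed.

Lemma wilson_poly_widen N n X d : (n < N)%N ->
  wilson_poly n X a b c d
  = \sum_(k < N) wilson_coef n k a b c d * (rising (a + X) k * rising (a - X) k).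
Proof.
move=> lt_nN; rewrite (sum_window (k := 0) (n := n)
  (F := fun k => wilson_coef n k a b c d * (rising (a + X) k * rising (a - X) k)))
  ?subn0 //.
by move=> j lt_nj; rewrite /wilson_coef bin_small // !mul0r.
Qed.

Lemma wilson_connection n X d :
  wilson_poly n X a b c d
  = \sum_(k < n.+1) connection_coef n k d * wilson_poly k X a b c h.
Proof.
pose phi j := rising (a + X) j * rising (a - X) j.
have phiE (j : 'I_n.+1) :
    phi j = \sum_(k < n.+1) wilson_inv_coef j k * wilson_poly k X a b c h.
  transitivity (\sum_(k < n.+1) \sum_(i < n.+1)
      wilson_inv_coef j k * wilson_coef k i a b c h * phi i).
    rewrite exchange_big /=.
    under eq_bigr => i _ do rewrite -mulr_suml sum_inv_wilson_coef //.
    rewrite (bigD1 j) //= eqxx mul1r big1 ?addr0 // => i ne_ij.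
    rewrite (_ : (j == i :> nat) = false) ?mul0r //.
    by apply/negbTE; rewrite eq_sym.
  apply: eq_bigr => k _; rewrite (wilson_poly_widen _ _ (ltn_ord k)) mulr_sumr.
  by apply: eq_bigr => i _; rewrite -mulrA.
rewrite /wilson_poly.
under eq_bigr => j _ do rewrite -/(phi j) phiE mulr_sumr.
rewrite exchange_big /=; apply: eq_bigr => k _.
rewrite -(sum_wilson_coef_inv _ _ (ltnSn n)) mulr_suml.
by apply: eq_bigr => j _; rewrite mulrA.
Qed.
End Connection.

(** * Geometrically dominated series and double series *)

Section Estimates.
Variable R : realType.
Implicit Types (z : R[i]) (u v : nat -> R[i]).

Lemma normc_ge0 z : 0 <= normc z.
Proof. by case: z => x y; exact: sqrtr_ge0. Qed.

Lemma normc_real (x : R) : 0 <= x -> normc x%:C = x.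
Proof. by move=> x0; rewrite /= expr0n addr0 sqrtr_sqr ger0_norm. Qed.

Lemma ler_normcB z w : normc (z - w) <= normc z + normc w.
Proof. by rewrite (le_trans (le_normcD _ _)) // normcN. Qed.

Lemma normcX z n : normc (z ^+ n) = normc z ^+ n.
Proof.
elim: n => [|n IHn]; first by rewrite !expr0 ComplexField.Normc.normc1.
by rewrite !exprS ComplexField.Normc.normcM IHn.
Qed.

Lemma ler_normc_sum n (F : 'I_n -> R[i]) :
  normc (\sum_(i < n) F i) <= \sum_(i < n) normc (F i).
Proof.
elim/big_ind2: _ => // [|x y z w xy zw]; first by rewrite ComplexField.Normc.normc0.
by rewrite (le_trans (le_normcD _ _)) // lerD.
Qed.

(** [R[i]^o] carries the topology of its [R[i]]-valued modulus; this moves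
    convergence to the real-valued [normc], where real analysis applies. *)
Lemma cvg_normcP u (l : R[i]) :
  ((fun n => normc (l - u n)) @ \oo --> (0 : R)) <->
  ((u : nat -> R[i]^o) @ \oo --> (l : R[i]^o)).
Proof.
split=> [/cvgrPdist_lt u_l|/cvgrPdist_lt u_l]; apply/cvgrPdist_lt => e e0.
  have [r re] : exists r, e = r%:C.
    by exists (complex.Re e); rewrite RRe_real // ger0_real // ltW.
  move: e0; rewrite re ltcE /= eqxx => /u_l; apply: filterS => n /=.
  by rewrite sub0r normrN ger0_norm ?normc_ge0 // ltcR.
have : 0 < e%:C by rewrite ltcE /= eqxx.
move=> /u_l; apply: filterS => n /=.
by rewrite sub0r normrN [X in _ -> X < _]ger0_norm ?normc_ge0 // -ltcR.
Qed.

Lemma lim_normc u (l : R[i]) : (fun n => normc (l - u n)) @ \oo --> (0 : R) ->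
  limn (u : nat -> R[i]^o) = l.
Proof. move/cvg_normcP/cvg_lim; apply; exact: norm_hausdorff. Qed.

(** Each of the n + 1 first terms of the geometric series is at least r^n. *)
Lemma mulrn_exp_le (r : R) n : 0 <= r < 1 -> n.+1%:R * r ^+ n <= (1 - r)^-1.
Proof.
move=> /andP[r0 r1].
have s0 : 0 < 1 - r by rewrite subr_gt0.
rewrite -[leRHS]div1r ler_pdivlMr //.
have le_sum : n.+1%:R * r ^+ n <= \sum_(i < n.+1) r ^+ i.
  rewrite mulr_natl -[X in _ *+ X]card_ord -sumr_const.
  by apply: ler_sum => i _; rewrite ler_wiXn2l ?leq_ord // ltW.
rewrite (le_trans (ler_wpM2r (ltW s0) le_sum)) //.
have -> : (\sum_(i < n.+1) r ^+ i) * (1 - r) = 1 - r ^+ n.+1.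
  by rewrite -[RHS]opprB subrX1; ring.
by rewrite gerBl exprn_ge0.
Qed.

(** A linear factor is absorbed by enlarging the ratio to (1 + r) / 2. *)
Lemma geometric_bound_mulrn (C r : R) : 0 <= C -> 0 <= r < 1 ->
  exists D q : R, [/\ 0 <= D, 0 <= q < 1
    & forall n, n.+1%:R * (C * r ^+ n) <= D * q ^+ n].
Proof.
move=> C0 /andP[r0 r1]; pose q := (1 + r) / 2.
have q0 : 0 < q by rewrite /q; lra.
have rq : r < q by rewrite /q; lra.
have rq1 : 0 <= r / q < 1 by rewrite divr_ge0 ?(ltW q0) //= ltr_pdivrMr // mul1r.
exists (C * (1 - r / q)^-1), q; split.
- by rewrite mulr_ge0 // invr_ge0 subr_ge0 ltW //; case/andP: rq1.
- by rewrite ltW //= /q; lra.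
move=> n; have le1 := ler_wpM2l C0 (mulrn_exp_le n rq1).
have := ler_wpM2r (exprn_ge0 n (ltW q0)) le1; apply: le_trans.
by rewrite expr_div_n !mulrA divfK ?expf_neq0 ?gt_eqF // [n.+1%:R * C]mulrC.
Qed.

Lemma geometric_mulrn_cvg0 (C q : R) : 0 <= C -> 0 <= q < 1 ->
  (fun n => n%:R * (C * q ^+ n)) @ \oo --> (0 : R).
Proof.
move=> C0 q01; have [D [r [D0 /andP[r0 r1] H]]] := geometric_bound_mulrn C0 q01.
have q0 : 0 <= q by case/andP: q01.
apply: (@squeeze_cvgr _ _ _ _ (fun=> 0) (fun n => D * r ^+ n)).
- apply: nearW => n; rewrite mulr_ge0 ?mulr_ge0 ?exprn_ge0 //=.
  by rewrite (le_trans _ (H n)) // ler_wpM2r ?mulr_ge0 ?exprn_ge0 // ler_nat.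
- exact: cvg_cst.
- by apply: cvg_geometric; rewrite ger0_norm.
Qed.

Lemma geometric_cvg0 (C q : R) : 0 <= q < 1 ->
  (fun n => C * q ^+ n) @ \oo --> (0 : R).
Proof. by case/andP=> q0 q1; apply: cvg_geometric; rewrite ger0_norm. Qed.

Lemma normc_le_ReIm z : normc z <= `|complex.Re z| + `|complex.Im z|.
Proof.
case: z => x y /=; rewrite -[leRHS]ger0_norm ?addr_ge0 // -sqrtr_sqr.
rewrite ler_wsqrtr // sqrrD !real_normK ?num_real // lerD2r lerDl.
by rewrite mulrn_wge0 // mulr_ge0.
Qed.

Lemma Re_le_normc z : `|complex.Re z| <= normc z.
Proof. by rewrite -lecR; exact: normc_ge_Re. Qed.

Lemma Im_le_normc z : `|complex.Im z| <= normc z.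
Proof.
case: z => x y /=; rewrite -sqrtr_sqr ler_wsqrtr // lerDr sqr_ge0 //.
Qed.

Lemma Re_series u n :
  complex.Re (series u n) = series (fun k => complex.Re (u k)) n.
Proof.
rewrite /series /=; elim/big_rec2: _ => // k x y _ <-.
by case: y (u k) => [a b] [].
Qed.

Lemma Im_series u n :
  complex.Im (series u n) = series (fun k => complex.Im (u k)) n.
Proof.
rewrite /series /=; elim/big_rec2: _ => // k x y _ <-.
by case: y (u k) => [a b] [].
Qed.

Section GeometricSeries.
Variables (u : nat -> R[i]) (C q : R).
Hypotheses (C0 : 0 <= C) (q01 : 0 <= q < 1).
Hypothesis u_le : forall n, normc (u n) <= C * q ^+ n.

Let q0 : 0 <= q. Proof. by case/andP: q01. Qed.
Let q1 : 0 < 1 - q. Proof. by case/andP: q01 => _; rewrite subr_gt0. Qed.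

Lemma series_tail_le n p :
  normc (series u (n + p)%N - series u n) <= C * (q ^+ n - q ^+ (n + p)) / (1 - q).
Proof.
elim: p => [|p IHp].
  by rewrite addn0 !subrr mulr0 mul0r ComplexField.Normc.normc0.
rewrite addnS /series /= big_nat_recr //= -[X in X <= _]/(normc _) -addrAC.
rewrite (le_trans (le_normcD _ _)) //.
rewrite (le_trans (lerD IHp (u_le (n + p)))) //.
rewrite -subr_ge0 (_ : _ - _ = 0) // exprS; field.
by rewrite gt_eqF.
Qed.

(** Completeness comes from the real and imaginary parts; the error estimate is
    kept because the exchange of summations needs it uniformly in the row. *)
Lemma geometric_series_cvg :
  exists l, forall n, normc (l - series u n) <= C / (1 - q) * q ^+ n.
Proof.
have cvg_part (f : R[i] -> R) : (forall z, `|f z| <= normc z) ->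
    cvgn (series (fun k => f (u k))).
  move=> f_le; apply: normed_cvg.
  apply: (@series_le_cvg _ _ (geometric C q)) => [n|n|n|].
  - exact: normr_ge0.
  - by rewrite /geometric /= mulr_ge0 ?exprn_ge0.
  - by rewrite (le_trans (f_le _)).
  - by apply: is_cvg_geometric_series; rewrite ger0_norm //; case/andP: q01.
pose x := limn (series (fun k => complex.Re (u k))).
pose y := limn (series (fun k => complex.Im (u k))).
have cx := cvg_part _ Re_le_normc; have cy := cvg_part _ Im_le_normc.
exists (x +i* y) => n.
have cvg_l : (fun p => normc (x +i* y - series u p)) @ \oo --> (0 : R).
  have cvg_sum : (fun p => `|x - series (fun k => complex.Re (u k)) p|
      + `|y - series (fun k => complex.Im (u k)) p|) @ \oo --> (0 : R).
    rewrite -[X in _ --> X](addr0 (0 : R)).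
    have cvg_dist (s : nat -> R) : cvgn s -> (fun p => `|limn s - s p|) @ \oo --> (0 : R).
      move=> cs; rewrite -[X in _ --> X](@normr0 R R) -(subrr (limn s)).
      by apply: cvg_norm; apply: cvgB => //; exact: cvg_cst.
    by apply: cvgD; exact: cvg_dist.
  apply: (squeeze_cvgr _ (cvg_cst 0) cvg_sum); apply: nearW => p.
  rewrite normc_ge0 (le_trans (normc_le_ReIm _)) //.
  by rewrite -Re_series -Im_series; case: (series u p).
move/cvgrPdist_lt in cvg_l; apply/ler_addgt0Pr => e e0.
near \oo => p.
have le_np : (n <= p)%N by near: p; exact: nbhs_infty_ge.
have lt_e : normc (x +i* y - series u p) < e.
  have : `|0 - normc (x +i* y - series u p)| < e by near: p; exact: cvg_l.
  by rewrite sub0r normrN ger0_norm ?normc_ge0.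
rewrite (_ : _ - _ = (x +i* y - series u p) + (series u p - series u n)).
  rewrite (le_trans (le_normcD _ _)) // addrC lerD ?(ltW lt_e) //.
  rewrite -{1}(subnKC le_np) (le_trans (series_tail_le _ _)) //.
  rewrite mulrAC ler_wpM2l ?divr_ge0 ?(ltW q1) //.
  by rewrite gerBl exprn_ge0.
by ring.
Unshelve. all: by end_near.
Qed.
End GeometricSeries.

(** The first N diagonals cut the k-th row, k < N, after N - k terms, so what is
    missing from it is O(q^k q^(N-k)) = O(q^N); there are N such rows. *)
Lemma series_rows_diagonals (t : nat -> nat -> R[i]) (C q : R) :
    0 <= C -> 0 <= q < 1 ->
    (forall k m, normc (t k m) <= C * q ^+ (k + m)) ->
  (fun N => normc (series (fun k => limn (series (t k) : nat -> R[i]^o)) N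
     - series (fun n => \sum_(k < n.+1) t k (n - k)%N) N)) @ \oo --> (0 : R).
Proof.
move=> C0 q01 t_le; have /andP[q0 q1] := q01.
have row_tail k m : normc (limn (series (t k) : nat -> R[i]^o) - series (t k) m)
    <= C / (1 - q) * q ^+ (k + m).
  have Ck0 : 0 <= C * q ^+ k by rewrite mulr_ge0 ?exprn_ge0.
  have tk_le i : normc (t k i) <= C * q ^+ k * q ^+ i by rewrite -mulrA -exprD.
  have [l l_tail] := geometric_series_cvg Ck0 q01 tk_le.
  have -> : limn (series (t k) : nat -> R[i]^o) = l.
    apply: lim_normc; apply: (squeeze_cvgr _ (cvg_cst 0) (geometric_cvg0 _ q01)).
    by apply: nearW => n; rewrite normc_ge0; exact: l_tail.
  by rewrite (le_trans (l_tail m)) // exprD mulrA [C * _ / _]mulrAC.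
have C'0 : 0 <= C / (1 - q) by rewrite divr_ge0 // subr_ge0 ltW.
apply: (squeeze_cvgr _ (cvg_cst 0) (geometric_mulrn_cvg0 C'0 q01)).
apply: nearW => N; rewrite normc_ge0 /=.
rewrite /series /= !big_mkord.
rewrite (sum_triangle N (fun n k => t k (n - k)%N)) -sumrB.
rewrite (le_trans (ler_normc_sum _)) //.
rewrite mulr_natl -[X in _ *+ X]card_ord -sumr_const; apply: ler_sum => k _.
have := row_tail k (N - k)%N; rewrite subnKC 1?ltnW // /series /= big_mkord.
by under [X in _ -> normc (_ - X) <= _]eq_bigr => i _ do rewrite addKn.
Qed.

(** For t k m = u k * v m, the rows sum to u k times the second limit, so that
    [series_rows_diagonals] compares the diagonals with the product. *)
Lemma cvg_cauchy_product u v (C q : R) :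
    0 <= C -> 0 <= q < 1 ->
    (forall n, normc (u n) <= C * q ^+ n) ->
    (forall n, normc (v n) <= C * q ^+ n) ->
  (fun N => normc (limn (series u : nat -> R[i]^o) * limn (series v : nat -> R[i]^o)
     - series (fun n => \sum_(k < n.+1) u k * v (n - k)%N) N)) @ \oo --> (0 : R).
Proof.
move=> C0 q01 u_le v_le; have /andP[q0 q1] := q01.
have series_lim (w : nat -> R[i]) (D : R) : 0 <= D ->
    (forall n, normc (w n) <= D * q ^+ n) ->
    (fun n => normc (limn (series w : nat -> R[i]^o) - series w n)) @ \oo --> (0 : R).
  move=> D0 w_le.
  have [l l_tail] := geometric_series_cvg D0 q01 w_le.
  have l_cvg : (fun n => normc (l - series w n)) @ \oo --> (0 : R).
    apply: (squeeze_cvgr _ (cvg_cst 0) (geometric_cvg0 _ q01)).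
    by apply: nearW => n; rewrite normc_ge0; exact: l_tail.
  by rewrite (lim_normc l_cvg).
have [lu lv] := (series_lim _ _ C0 u_le, series_lim _ _ C0 v_le).
set U := limn (series u : nat -> R[i]^o) in lu *.
set V := limn (series v : nat -> R[i]^o) in lv *.
have uv_le k m : normc (u k * v m) <= C ^+ 2 * q ^+ (k + m).
  rewrite ComplexField.Normc.normcM exprD expr2 mulrACA.
  by rewrite ler_pM ?normc_ge0.
have := series_rows_diagonals (sqr_ge0 C) q01 uv_le.
have -> : (fun k => limn (series (fun m => u k * v m) : nat -> R[i]^o))
   = (fun k => u k * V).
  apply/funext => k; apply: lim_normc.
  have -> : (fun n => normc (u k * V - series (fun m => u k * v m) n))
    = (fun n => normc (u k) * normc (V - series v n)).
    apply/funext => n; rewrite /series /= -mulr_sumr -mulrBr.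
    exact: ComplexField.Normc.normcM.
  by rewrite -[X in _ --> X](mulr0 (normc (u k))); apply: cvgM => //; exact: cvg_cst.
move=> rd_cvg.
have : (fun N => normc (U - series u N) * normc V
   + normc (series (fun k => u k * V) N
     - series (fun n => \sum_(k < n.+1) u k * v (n - k)%N) N)) @ \oo --> (0 : R).
  rewrite -[X in _ --> X](addr0 (0 : R)); apply: cvgD => //.
  by rewrite -[X in _ --> X](mul0r (normc V)); apply: cvgM => //; exact: cvg_cst.
move=> bound_cvg; apply: (squeeze_cvgr _ (cvg_cst 0) bound_cvg).
apply: nearW => N; rewrite normc_ge0 /= -ComplexField.Normc.normcM.
rewrite (le_trans _ (le_normcD _ _)) //.
rewrite (_ : series (fun k => u k * V) N = series u N * V); last first.
  by rewrite /series /= mulr_suml.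
by rewrite mulrBl addrA subrK.
Qed.

Lemma cvg_interchange (t : nat -> nat -> R[i]) (L : R[i]) (C q : R) :
    0 <= C -> 0 <= q < 1 ->
    (forall k m, normc (t k m) <= C * q ^+ (k + m)) ->
    (fun N => normc (L - series (fun n => \sum_(k < n.+1) t k (n - k)%N) N))
      @ \oo --> (0 : R) ->
  (series (fun k => limn (series (t k) : nat -> R[i]^o)) : nat -> R[i]^o)
    @ \oo --> (L : R[i]^o).
Proof.
move=> C0 q01 t_le L_cvg; apply/cvg_normcP.
set rows := (fun k => limn _).
set diags := (fun n => \sum_(k < n.+1) t k (n - k)%N) in L_cvg.
have bound_cvg : (fun N => normc (L - series diags N)
    + normc (series rows N - series diags N)) @ \oo --> (0 : R).
  rewrite -[X in _ --> X](addr0 (0 : R)); apply: cvgD => //.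
  exact: series_rows_diagonals C0 q01 t_le.
apply: (squeeze_cvgr _ (cvg_cst 0) bound_cvg).
apply: nearW => N; rewrite normc_ge0 /=.
by rewrite (le_trans _ (ler_normcB _ _)) // opprB addrA subrK.
Qed.
End Estimates.

(** * Growth of rising factorials *)

Section Growth.
Variable R : realType.
Implicit Types (z : R[i]).

(** Bernoulli's inequality (1 + 1/x)^M >= 1 + M/x, cleared of denominators. *)
Lemma bernoulli_shift (x : R) M : 0 <= x -> x ^+ M * (x + M%:R) <= (x + 1) ^+ M * x.
Proof.
move=> x0; elim: M => [|M IHM]; first by rewrite !expr0 addr0.
have x10 : 0 <= x + 1 by rewrite addr_ge0.
rewrite [leRHS](_ : _ = (x + 1) * ((x + 1) ^+ M * x)); last by rewrite exprS; ring.
rewrite (le_trans _ (ler_wpM2l x10 IHM)) // -subr_ge0.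
rewrite (_ : _ - _ = x ^+ M * M%:R); last by rewrite -natr1 exprSr; ring.
by rewrite mulr_ge0 ?exprn_ge0.
Qed.

Lemma normc_nat n : normc n%:R = n%:R :> R.
Proof. by rewrite -(rmorph_nat (real_complex R)) normc_real. Qed.

(** |z+j| / (j+1) is at most ((j+2)/(j+1))^M, a bound whose product over j
    telescopes to a power of M. *)
Lemma factor_upper z (M : nat) j : normc z <= M%:R ->
  normc (z + j%:R) * j.+1%:R ^+ M <= j.+1%:R * j.+2%:R ^+ M.
Proof.
move=> z_le; have := bernoulli_shift M (ler0n R j.+1); rewrite natr1 [leRHS]mulrC.
apply: le_trans; rewrite mulrC ler_wpM2l ?exprn_ge0 // (le_trans (le_normcD _ _)) //.
rewrite normc_nat addrC -natr1 -addrA lerD2l (le_trans z_le) //.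
by rewrite lerDr.
Qed.

Lemma Re_addn z j : complex.Re (z + j%:R) = complex.Re z + j%:R.
Proof. by rewrite -(rmorph_nat (real_complex R)); case: z. Qed.

(** The matching lower bound follows from |z+j| >= Re z + j as soon as
    M Re z >= 1; because of j = 0, M has to grow when Re z approaches 0. *)
Lemma factor_lower z (M : nat) j : 0 < complex.Re z -> (complex.Re z)^-1 <= M%:R ->
  j.+1%:R * j.+1%:R ^+ M <= normc (z + j%:R) * j.+2%:R ^+ M.
Proof.
move=> z0 z_le; set s := complex.Re z in z0 z_le.
have sM : 1 <= M%:R * s by rewrite -ler_pdivrMr // div1r.
have le_norm : s + j%:R <= normc (z + j%:R).
  by rewrite (le_trans _ (Re_le_normc _)) // Re_addn ler_norm.
rewrite (le_trans _ (ler_wpM2r (exprn_ge0 M (ler0n R j.+2)) le_norm)) //.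
have M1 : 1 <= M%:R :> R.
  by rewrite ler1n lt0n; apply: contraTneq sM => ->; rewrite mul0r ler10.
have j0 : 0 <= j%:R :> R by [].
have p0 : 0 <= j.+1%:R ^+ M :> R by rewrite exprn_ge0.
have := bernoulli_shift M (ler0n R j.+1); rewrite !natr1.
move: (j.+2%:R ^+ M) => y; move: p0; rewrite -natr1.
move: (_ ^+ M) => p p0 H.
have x0 : 0 < j%:R + 1 :> R by rewrite ltr_wpDl.
rewrite -(ler_pM2r x0) -mulrA.
rewrite (le_trans _ (ler_wpM2l _ H)) ?addr_ge0 ?(ltW z0) // -subr_ge0.
rewrite [X in 0 <= X](_ : _ = p * (j%:R * (M%:R + s - 1) + (s + (M%:R * s - 1))));
  last by ring.
by rewrite mulr_ge0 // addr_ge0 ?mulr_ge0 //; lra.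
Qed.

Lemma rising_upper z (M : nat) n k : normc z <= M%:R ->
  n`!%:R * normc (rising (z + n%:R) k) <= (n + k)`!%:R * (n + k).+1%:R ^+ M.
Proof.
move=> z_le.
(* The factor (n+1)^M is the denominator of the telescoped product. *)
suff H : n`!%:R * normc (rising (z + n%:R) k) * n.+1%:R ^+ M
    <= (n + k)`!%:R * (n + k).+1%:R ^+ M.
  by rewrite (le_trans _ H) // ler_peMr ?mulr_ge0 ?normc_ge0 // exprn_ege1 // ler1n.
elim: k => [|k IHk].
  by rewrite rising0 ComplexField.Normc.normc1 mulr1 addn0.
rewrite risingSr ComplexField.Normc.normcM -addrA -natrD addnS factS natrM.
have leB := factor_upper (n + k) z_le.
have x0 : 0 < (n + k).+1%:R ^+ M :> R by rewrite exprn_gt0 // ltr0n.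
rewrite -(ler_pM2r x0).
have A0 : 0 <= n`!%:R * normc (rising (z + n%:R) k) * n.+1%:R ^+ M.
  by rewrite !mulr_ge0 ?normc_ge0 ?exprn_ge0.
have B0 : 0 <= normc (z + (n + k)%:R) * (n + k).+1%:R ^+ M.
  by rewrite mulr_ge0 ?normc_ge0 ?exprn_ge0.
have := ler_pM A0 B0 IHk leB.
by congr (_ <= _); ring.
Qed.

Lemma rising_lower z (M : nat) n k : 0 < complex.Re z -> (complex.Re z)^-1 <= M%:R ->
  (n + k)`!%:R <= n`!%:R * normc (rising (z + n%:R) k) * (n + k).+1%:R ^+ M.
Proof.
move=> z0 z_le.
suff H : (n + k)`!%:R * n.+1%:R ^+ M
    <= n`!%:R * normc (rising (z + n%:R) k) * (n + k).+1%:R ^+ M.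
  by rewrite (le_trans _ H) // ler_peMr // exprn_ege1 // ler1n.
elim: k => [|k IHk].
  by rewrite rising0 ComplexField.Normc.normc1 mulr1 addn0.
rewrite risingSr ComplexField.Normc.normcM -addrA -natrD addnS factS natrM.
have leB := factor_lower (n + k) z0 z_le.
have x0 : 0 < (n + k).+1%:R ^+ M :> R by rewrite exprn_gt0 // ltr0n.
rewrite -(ler_pM2r x0).
have A0 : 0 <= (n + k)`!%:R * n.+1%:R ^+ M :> R by rewrite mulr_ge0 ?exprn_ge0.
have B0 : 0 <= (n + k).+1%:R * (n + k).+1%:R ^+ M :> R.
  by rewrite mulr_ge0 ?exprn_ge0.
have := ler_pM A0 B0 IHk leB.
by congr (_ <= _); ring.
Qed.

(** Bookkeeping for products: r is the factorial part of the size of z, which is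
    to cancel in the end, and p counts the powers of the large scale Y lost on
    the way. *)
Definition pbound (Y : R) z (r : R) (p : nat) := normc z <= r * Y ^+ p.

Lemma pboundM Y z w r s p q : pbound Y z r p -> pbound Y w s q ->
  pbound Y (z * w) (r * s) (p + q).
Proof.
move=> zr ws; rewrite /pbound ComplexField.Normc.normcM exprD mulrACA.
by rewrite ler_pM ?normc_ge0.
Qed.

Lemma pbound_sum Y n (F : 'I_n.+1 -> R[i]) r p : 0 <= r -> n.+1%:R <= Y ->
  (forall i, pbound Y (F i) r p) -> pbound Y (\sum_i F i) r p.+1.
Proof.
move=> r0 nY F_le; rewrite /pbound (le_trans (ler_normc_sum _)) //.
rewrite (le_trans (ler_sum _ (fun i _ => F_le i))) //.
rewrite sumr_const card_ord -mulr_natl exprS mulrCA ler_wpM2l //.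
by rewrite ler_wpM2r // exprn_ge0 // (le_trans _ nY).
Qed.

Lemma pbound_nat Y n : pbound Y n%:R n%:R 0.
Proof. by rewrite /pbound normc_nat expr0 mulr1. Qed.

Lemma pbound_natV Y n : pbound Y n%:R^-1 n%:R^-1 0.
Proof. by rewrite /pbound ComplexField.Normc.normcV normc_nat expr0 mulr1. Qed.

Lemma pbound_rising Y z (M : nat) n k : normc z <= M%:R -> (n + k).+1%:R <= Y ->
  pbound Y (rising (z + n%:R) k) ((n + k)`!%:R / n`!%:R) M.
Proof.
move=> z_le nkY; rewrite /pbound.
have n0 : 0 < n`!%:R :> R by rewrite ltr0n fact_gt0.
rewrite -(ler_pM2l n0) (le_trans (rising_upper _ _ z_le)) //.
rewrite mulrA mulrCA divff ?gt_eqF // mulr1 ler_wpM2l //.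
by rewrite lerXn2r // nnegrE // (le_trans _ nkY).
Qed.

Lemma pbound_risingV Y z (M : nat) n k :
    0 < complex.Re z -> (complex.Re z)^-1 <= M%:R -> (n + k).+1%:R <= Y ->
  pbound Y (rising (z + n%:R) k)^-1 (n`!%:R / (n + k)`!%:R) M.
Proof.
move=> z0 z_le nkY; rewrite /pbound ComplexField.Normc.normcV.
have n0 : 0 < n`!%:R :> R by rewrite ltr0n fact_gt0.
have nk0 : 0 < (n + k)`!%:R :> R by rewrite ltr0n fact_gt0.
have le1 := rising_lower n k z0 z_le.
have norm0 : 0 < normc (rising (z + n%:R) k).
  rewrite lt_neqAle normc_ge0 andbT; apply: contraTneq le1 => <-.
  by rewrite mulr0 mul0r -ltNge.
rewrite -[leLHS]div1r ler_pdivrMr //.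
rewrite [leRHS](_ : _ = n`!%:R * normc (rising (z + n%:R) k) * Y ^+ M
  / (n + k)`!%:R); last by ring.
rewrite ler_pdivlMr // mul1r (le_trans le1) // ler_wpM2l ?mulr_ge0 ?normc_ge0 //.
by rewrite lerXn2r // nnegrE // (le_trans _ nkY).
Qed.
End Growth.

(** * The expansion *)

Section WilsonExpansion.
Variable R : realType.
Implicit Types (z : R[i]).

Lemma pochhammerE z n : pochhammer z n = rising z n.
Proof.
rewrite /pochhammer /rising big_add1 /= big_mkord.
by apply: eq_bigr => i _; rewrite -natr1 addrA addrK.
Qed.

Lemma ReD z w : complex.Re (z + w) = complex.Re z + complex.Re w.
Proof. by case: z w => [x y] []. Qed.

Lemma Re_gt0_neq0 z n : 0 < complex.Re z -> z + n%:R != 0.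
Proof.
move=> z0; apply: contraTneq (ltr_wpDr (ler0n R n) z0).
by rewrite -Re_addn => ->; rewrite ltxx.
Qed.

Lemma Re_gt0_rising_neq0 z n k : 0 < complex.Re z -> rising (z + n%:R) k != 0.
Proof.
by move=> z0; apply: rising_neq0 => m; rewrite -addrA -natrD Re_gt0_neq0.
Qed.

Lemma lim_finite_series (u : nat -> R[i]) n : (forall k, (n < k)%N -> u k = 0) ->
  limn (series u : nat -> R[i]^o) = \sum_(k < n.+1) u k.
Proof.
move=> u0; apply: lim_normc; apply: (cvg_near_cst).
exists n.+1 => // N /= lt_nN; rewrite /series /=.
rewrite (big_cat_nat (n := n.+1)) //= [X in _ - (_ + X)]big_nat.
rewrite [X in _ - (_ + X)]big1 => [|k /andP[/u0]] //.
by rewrite addr0 big_mkord subrr ComplexField.Normc.normc0.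
Qed.

(** The numerator parameter -n is what terminates the Wilson 4F3. *)
Lemma rising_oppn n k : rising (- n%:R : R[i]) k = (-1) ^+ k * (n ^_ k)%:R.
Proof.
elim: k => [|k IHk]; first by rewrite rising0 ffactn0 mulr1.
rewrite risingSr IHk ffactnSr exprSr natrM; case: (leqP k n) => [le_kn|lt_nk].
  by rewrite natrB //; ring.
by rewrite ffact_small // !(mul0r, mulr0).
Qed.

Lemma wilsonE n (x : R) a b c d :
    0 < complex.Re a -> 0 < complex.Re b -> 0 < complex.Re c -> 0 < complex.Re d ->
  wilson n x a b c d = wilson_poly n ('i%C * x%:C) a b c d.
Proof.
move=> a0 b0 c0 d0; rewrite /wilson /pFq (lim_finite_series (n := n)); last first.
  move=> k lt_nk; rewrite /pFq_term big_cons pochhammerE rising_oppn ffact_small //.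
  by rewrite mulr0 !mul0r.
rewrite mulr_sumr; apply: eq_bigr => k _; move: (nat_of_ord k) (leq_ord k) => {}k le_kn.
rewrite /pFq_term !(big_cons, big_nil) !pochhammerE rising_oppn -bin_ffact natrM.
have risingN z : rising z n = rising z k * rising (z + k%:R) (n - k).
  by rewrite -risingD subnKC.
rewrite expr1n /wilson_coef !risingN.
have k0 : k`!%:R != 0 :> R[i] by rewrite pnatr_eq0 -lt0n fact_gt0.
have nz z : 0 < complex.Re z -> rising z k != 0.
  by move=> z0; have := Re_gt0_rising_neq0 0 k z0; rewrite addr0.
have ab0 : rising (a + b) k != 0 by rewrite nz // ReD addr_gt0.
have ac0 : rising (a + c) k != 0 by rewrite nz // ReD addr_gt0.
have ad0 : rising (a + d) k != 0 by rewrite nz // ReD addr_gt0.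
by field; rewrite ab0 ac0 ad0 k0.
Qed.

(** Boundedness is asked of the multiple because it is the one known for
    [double_term]; for K <> 0 it passes to u, and for K = 0 both sides are 0
    whether u is summable or not. *)
Lemma lim_series_scale (u : nat -> R[i]) (K : R[i]) (C q : R) : 0 <= C -> 0 <= q < 1 ->
    (forall n, normc (K * u n) <= C * q ^+ n) ->
  limn (series (fun n => K * u n) : nat -> R[i]^o)
  = K * limn (series u : nat -> R[i]^o).
Proof.
move=> C0 q01 Ku_le; have [->|K0] := eqVneq K 0.
  rewrite mul0r (lim_finite_series (n := 0)) ?big_ord1 ?mul0r // => k _.
  by rewrite mul0r.
have [l l_tail] := geometric_series_cvg C0 q01 Ku_le.
have l_cvg : (fun n => normc (l - series (fun n => K * u n) n)) @ \oo --> (0 : R).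
  apply: (squeeze_cvgr _ (cvg_cst 0) (geometric_cvg0 _ q01)).
  by apply: nearW => n; rewrite normc_ge0; exact: l_tail.
rewrite (lim_normc l_cvg) (@lim_normc _ (series u) (K^-1 * l)) ?mulVKf //.
rewrite -[X in _ --> X](mulr0 (normc K^-1)).
rewrite [X in X @ _](_ : _ = (fun n => normc K^-1 * normc (l - series (fun n => K * u n) n))).
  by apply: cvgM => //; exact: cvg_cst.
apply/funext => n; rewrite -ComplexField.Normc.normcM mulrBr /series /=.
by rewrite -mulr_sumr mulKf.
Qed.

Lemma exists_nat_bound (s : seq R) : exists M : nat, all (fun x => x <= M%:R) s.
Proof.
elim: s => [|x s [M sM]]; first by exists 0%N.
exists (M + Num.bound `|x|)%N => /=; rewrite natrD; apply/andP; split.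
  rewrite (le_trans (ler_norm x)) // (le_trans (ltW (archi_boundP (normr_ge0 x)))) //.
  by rewrite lerDr.
by apply: sub_all sM => y /le_trans; apply; rewrite lerDl.
Qed.

(** At least (n + k).+1 for all k <= n, so that its powers absorb the polynomial
    factors lost in the term of degree n. *)
Definition scale (n : nat) : R := (2 * n.+1)%:R.

Lemma scale_exp_le (r : R) P : 0 <= r < 1 -> exists C q : R,
  [/\ 0 <= C, 0 <= q < 1 & forall n, scale n ^+ P * r ^+ n <= C * q ^+ n].
Proof.
move=> r01; elim: P => [|P [C [q [C0 q01 H]]]].
  by exists 1, r; split=> // n; rewrite expr0.
have [D [q' [D0 q'01 H']]] := geometric_bound_mulrn (mulr_ge0 (ler0n R 2) C0) q01.
exists D, q'; split=> // n; apply: le_trans (H' n).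
rewrite exprS {1}/scale natrM -!mulrA mulrCA ler_wpM2l // ler_wpM2l //.
Qed.

Lemma natr_fact_neq0 n : n`!%:R != 0 :> R.
Proof. by rewrite pnatr_eq0 -lt0n fact_gt0. Qed.

Lemma pbound_rising0 (Y : R) z (M : nat) k : normc z <= M%:R -> k.+1%:R <= Y ->
  pbound Y (rising z k) k`!%:R M.
Proof.
move=> z_le kY; have := @pbound_rising R Y z M 0 k z_le kY.
by rewrite addr0 fact0 divr1.
Qed.

Lemma pbound_rising0V (Y : R) z (M : nat) k : 0 < complex.Re z ->
    (complex.Re z)^-1 <= M%:R -> k.+1%:R <= Y ->
  pbound Y (rising z k)^-1 k`!%:R^-1 M.
Proof.
move=> z0 z_le kY; have := @pbound_risingV R Y z M 0 k z0 z_le kY.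
by rewrite addr0 fact0 div1r.
Qed.

Lemma pboundW (Y : R) z r s p : pbound Y z r p -> r = s -> pbound Y z s p.
Proof. by move=> + <-. Qed.

(** The Whipple form of W_k is a sum of k + 1 terms of size k!^3; the largest
    terms of the defining form exceed this by a factor exponential in k. *)
Lemma pbound_wilson_poly (Y : R) X a b c h (M : nat) k :
    normc (a + X) <= M%:R -> normc (b + X) <= M%:R -> normc (a + b) <= M%:R ->
    normc (c - X) <= M%:R -> normc (h - X) <= M%:R -> normc (c + h) <= M%:R ->
    k.+1%:R <= Y ->
  pbound Y (wilson_poly k X a b c h) (k`!%:R ^+ 3) (6 * M).+1.
Proof.
move=> aX bX ab cX hX ch kY; rewrite -whipple.
apply: pbound_sum => // -[j lt_jk].
have le_jk : (j <= k)%N by rewrite -ltnS.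
have leY m : (m <= k)%N -> m.+1%:R <= Y.
  by move=> le_mk; rewrite (le_trans _ kY) // ler_nat.
rewrite /= (_ : 6 * M = 0 + (M + M + M + (M + M + M)))%N; last by lia.
apply: pboundW.
  apply: pboundM; first exact: pbound_nat.
  apply: pboundM; apply: pboundM; try apply: pboundM.
  - by apply: (pbound_rising0 aX); exact: leY.
  - by apply: (pbound_rising0 bX); exact: leY.
  - by apply: (pbound_rising ab); rewrite subnKC.
  - by apply: (pbound_rising0 cX); apply: leY; rewrite leq_subr.
  - by apply: (pbound_rising0 hX); apply: leY; rewrite leq_subr.
  - by apply: (pbound_rising ch); rewrite subnK.
rewrite subnKC // subnK // -(bin_fact le_jk) !natrM; field.
by rewrite !natr_fact_neq0.
Qed.

(** The base k + z - 1 has positive real part only for k > 0, where the size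
    (2k-1)!/(k-1)! of the product is (2k)!/k! up to a factor 2; for k = 0 the
    product is empty. *)
Lemma pbound_rising_predV (Y : R) z (M : nat) k : 0 < complex.Re z ->
    (complex.Re z)^-1 <= M%:R -> (2 * k).+1%:R <= Y ->
  pbound Y (rising (k%:R + z - 1) k)^-1 (2 * (k`!%:R / (2 * k)`!%:R)) M.
Proof.
move=> z0 z_le; case: k => [|k] kY.
  rewrite rising0 fact0 divr1 mulr1 /pbound invr1.
  rewrite ComplexField.Normc.normc1 (le_trans (_ : 1 <= 2)) ?ler1n //.
  by rewrite ler_peMr // exprn_ege1.
rewrite (_ : _ - 1 = z + k%:R); last by rewrite -natr1; ring.
apply: pboundW.
  by apply: (pbound_risingV z0 z_le (n := k)); rewrite (le_trans _ kY) // ler_nat; lia.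
rewrite (_ : k + k.+1 = (2 * k).+1)%N; last by lia.
rewrite (_ : 2 * k.+1 = (2 * k).+2)%N; last by lia.
rewrite [k.+1`!]factS [(2 * k).+2`!]factS !natrM.
rewrite (_ : (2 * k).+2%:R = 2 * k.+1%:R); last by rewrite -natrM mulnS.
field; rewrite !natr_fact_neq0 /=.
by apply/andP; split; rewrite gt_eqF // ltr_pwDl // mulr_ge0.
Qed.

Lemma ler_scale n i : (i <= 2 * n + 1)%N -> i.+1%:R <= scale n.
Proof. by move=> le_in; rewrite /scale ler_nat; lia. Qed.

Section Terms.
Variables (rho X a b c d h : R[i]).
Hypotheses (a0 : 0 < complex.Re a) (b0 : 0 < complex.Re b) (c0 : 0 < complex.Re c).
Hypotheses (d0 : 0 < complex.Re d) (h0 : 0 < complex.Re h).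
Hypothesis rho_lt1 : `|rho| < 1.

(** The term of degree n = k + m in rho that comes from W_k once W_n(x^2; a, b,
    c, d) has been expanded over the polynomials of parameter h. *)
Definition double_term (k m : nat) : R[i] :=
  rho ^+ (k + m) * (connection_coef a b c h (k + m) k d * wilson_poly k X a b c h
    / (rising (a + b) (k + m) * rising (c + d) (k + m) * (k + m)`!%:R)).

Let normc_rho : 0 <= normc rho < 1.
Proof. by rewrite normc_ge0 /=; move: rho_lt1; rewrite -[1]/(1%:C) ltcR. Qed.

Let ReD_gt0 z w : 0 < complex.Re z -> 0 < complex.Re w -> 0 < complex.Re (z + w).
Proof. by rewrite ReD; exact: addr_gt0. Qed.

(** One M serves for all the parameters.  The factorial parts of the factors
    multiply up to the constant 2. *)
Lemma double_term_bounded : exists C q : R, [/\ 0 <= C, 0 <= q < 1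
  & forall k m, normc (double_term k m) <= C * q ^+ (k + m)].
Proof.
have [M /=] := exists_nat_bound [:: normc (a + X); normc (b + X); normc (a + b);
  normc (c - X); normc (h - X); normc (c + h); normc (a + b + c + d - 1);
  normc (d - h); normc (a + c); normc (b + c);
  (complex.Re (a + b + c + h))^-1; (complex.Re (a + b))^-1;
  (complex.Re (c + d))^-1].
case/and5P=> aX bX ab cX /and5P[hX ch sd dh /and5P[ac bc sh abV /andP[cdV _]]].
have [C [q [C0 q01 Cq]]] := scale_exp_le
  (0 + (M + M + (M + M + M)) + (M + M) + (6 * M).+1 + (M + M + 0)) normc_rho.
exists (2 * C), q; split=> // [|k m]; first by rewrite mulr_ge0.
set n := (k + m)%N.
rewrite /double_term -/n ComplexField.Normc.normcM normcX mulrC.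
have nkE : (n - k = m)%N := addKn k m.
have [kY mY nY] : [/\ k.+1%:R <= scale n, m.+1%:R <= scale n & n.+1%:R <= scale n].
  by split; apply: ler_scale; rewrite /n; clear; lia.
have nkY : (n + k).+1%:R <= scale n by apply: ler_scale; rewrite /n; clear; lia.
have kmE : (2 * k + m = n + k)%N by rewrite /n; clear; lia.
have sh0 : 0 < complex.Re (a + b + c + h) by rewrite !ReD_gt0.
have predV : pbound (scale n) (rising (k%:R + a + b + c + h - 1) k)^-1
    (2 * (k`!%:R / (2 * k)`!%:R)) M.
  rewrite (_ : k%:R + a + b + c + h - 1 = k%:R + (a + b + c + h) - 1); last by ring.
  apply: pbound_rising_predV => //; apply: le_trans nkY.
  by rewrite -kmE ler_nat ltnS leq_addr.
suff : pbound (scale n) (connection_coef a b c h n k d * wilson_poly k X a b c h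
    / (rising (a + b) n * rising (c + d) n * n`!%:R)) 2
    (0 + (M + M + (M + M + M)) + (M + M) + (6 * M).+1 + (M + M + 0)).
  rewrite /pbound => /(ler_wpM2r (exprn_ge0 n (normc_ge0 rho)))/le_trans; apply.
  by rewrite -!mulrA ler_wpM2l.
rewrite /connection_coef !invfM nkE.
apply: pboundW.
  do 4?[apply: pboundM]; last first.
  - exact: pbound_natV.
  - by apply: (pbound_rising0V _ cdV); rewrite ?ReD_gt0.
  - by apply: (pbound_rising0V _ abV); rewrite ?ReD_gt0.
  - exact: (pbound_wilson_poly aX bX ab cX hX ch).
  - rewrite (_ : (2 * k)%:R + a + b + c + h = a + b + c + h + (2 * k)%:R); last by ring.
    by apply: (pbound_risingV sh0 sh); rewrite kmE.
  - exact: predV.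
  - apply: pboundM; last (apply: pboundM; first apply: pboundM).
    + rewrite (_ : n%:R + a + b + c + d - 1 = a + b + c + d - 1 + n%:R); last by ring.
      exact: (pboundM (pbound_rising sd nkY) (pbound_rising0 dh mY)).
    + by apply: (pbound_rising ab).
    + by apply: (pbound_rising ac).
    + by apply: (pbound_rising bc).
  - exact: pbound_nat.
rewrite kmE -/n -(bin_fact (leq_addr m k : (k <= n)%N)) nkE !natrM.
have bin0 : 'C(n, k)%:R != 0 :> R by rewrite pnatr_eq0 -lt0n bin_gt0 leq_addr.
by field; rewrite bin0 !natr_fact_neq0.
Qed.

Let Re_gt0_rising0 z k : 0 < complex.Re z -> rising z k != 0.
Proof. by move=> z0; have := Re_gt0_rising_neq0 0 k z0; rewrite addr0. Qed.

Let abch_neq0 m : a + b + c + h + m%:R != 0.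
Proof. by rewrite Re_gt0_neq0 // !ReD_gt0. Qed.

Definition left_term := pFq_term [:: a + X; b + X] [:: a + b] rho.
Definition right_term := pFq_term [:: c - X; d - X] [:: c + d] rho.

Lemma left_right_term_bounded : exists C q : R, [/\ 0 <= C, 0 <= q < 1,
    forall n, normc (left_term n) <= C * q ^+ n
  & forall n, normc (right_term n) <= C * q ^+ n].
Proof.
have [M /=] := exists_nat_bound [:: normc (a + X); normc (b + X); normc (c - X);
  normc (d - X); (complex.Re (a + b))^-1; (complex.Re (c + d))^-1].
case/and5P=> aX bX cX dX /and3P[abV cdV _].
have [C [q [C0 q01 Cq]]] := scale_exp_le (M + M + M + 0) normc_rho.
suff H (y z w : R[i]) : normc y <= M%:R -> normc z <= M%:R ->
    0 < complex.Re w -> (complex.Re w)^-1 <= M%:R ->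
    forall n, normc (pFq_term [:: y; z] [:: w] rho n) <= C * q ^+ n.
  by exists C, q; split=> // n; apply: H; rewrite ?ReD_gt0.
move=> yM zM w0 wM n; rewrite /pFq_term !(big_cons, big_nil) !pochhammerE !mulr1.
have nY : n.+1%:R <= scale n by apply: ler_scale; clear; lia.
rewrite mulrA mulrAC ComplexField.Normc.normcM normcX (le_trans _ (Cq n)) //.
rewrite ler_wpM2r ?exprn_ge0 ?normc_ge0 //.
rewrite -[leRHS]mul1r; apply: pboundW.
  apply: pboundM; last exact: pbound_natV.
  apply: pboundM; last exact: (pbound_rising0V w0 wM nY).
  exact: (pboundM (pbound_rising0 yM nY) (pbound_rising0 zM nY)).
by field; rewrite natr_fact_neq0.
Qed.

(** Both sides are W_n(x^2; a, b, c, d) rho^n / ((a+b)_n (c+d)_n n!), the left one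
    by [wilson_connection] and the right one by [whipple]. *)
Lemma sum_double_term n : \sum_(k < n.+1) double_term k (n - k)
  = \sum_(j < n.+1) left_term j * right_term (n - j).
Proof.
pose K := rho ^+ n / (rising (a + b) n * rising (c + d) n * n`!%:R).
transitivity (K * wilson_poly n X a b c d).
  rewrite (wilson_connection abch_neq0) mulr_sumr; apply: eq_bigr => k _.
  by rewrite /double_term subnKC ?leq_ord // /K; ring.
rewrite -whipple mulr_sumr; apply: eq_bigr => -[j /= lt_jn] _.
have le_jn : (j <= n)%N by rewrite -ltnS.
rewrite /left_term /right_term /pFq_term !(big_cons, big_nil) !pochhammerE.
have nfact k : k`!%:R != 0 :> R[i] by rewrite pnatr_eq0 -lt0n fact_gt0.
have binE : 'C(n, j)%:R = n`!%:R / (j`!%:R * (n - j)`!%:R) :> R[i].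
  by rewrite -(bin_fact le_jn) !natrM mulfK // mulf_neq0.
have abE : rising (a + b) n = rising (a + b) j * rising (a + b + j%:R) (n - j).
  by rewrite -risingD subnKC.
have cdE : rising (c + d) n
    = rising (c + d) (n - j) * rising (c + d + (n - j)%:R) j.
  by rewrite -risingD subnK.
have rhoE : rho ^+ n = rho ^+ j * rho ^+ (n - j) by rewrite -exprD subnKC.
have ab0 : rising (a + b) j != 0 by rewrite Re_gt0_rising0 ?ReD_gt0.
have cd0 : rising (c + d) (n - j) != 0 by rewrite Re_gt0_rising0 ?ReD_gt0.
have abj0 : rising (a + b + j%:R) (n - j) != 0.
  by rewrite Re_gt0_rising_neq0 ?ReD_gt0.
have cdj0 : rising (c + d + (n - j)%:R) j != 0.
  by rewrite Re_gt0_rising_neq0 ?ReD_gt0.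
rewrite /K binE abE cdE rhoE; field.
by rewrite !nfact ab0 cd0 abj0 cdj0.
Qed.

Lemma row_sum (f : nat -> R[i]) (K : R[i]) k :
    (forall m, double_term k m = K * f m) ->
  limn (series (double_term k) : nat -> R[i]^o) = K * limn (series f : nat -> R[i]^o).
Proof.
move=> dtE; rewrite (_ : double_term k = (fun m => K * f m)); last exact/funext.
have [C [q [C0 q01 dt_le]]] := double_term_bounded.
have q0 : 0 <= q by case/andP: q01.
apply: (lim_series_scale (mulr_ge0 C0 (exprn_ge0 k q0)) q01) => m.
by rewrite -dtE -mulrA -exprD.
Qed.

Definition expansion_coef k : R[i] :=
  rising (k%:R + a + b + c + d - 1) k
    / (rising (k%:R + a + b + c + h - 1) k
       * rising (a + b) k * rising (c + d) k * k`!%:R)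
  * rho ^+ k * wilson_poly k X a b c h.

(** For k = 0 the factor (m+a+b+c+d-1)_k of [connection_coef] is empty, so that
    the possibly vanishing parameter a+b+c+d-1 does not occur. *)
Lemma double_term0 m : double_term 0 m = expansion_coef 0
  * pFq_term [:: d - h; a + c; b + c] [:: a + b + c + h; c + d] rho m.
Proof.
rewrite /double_term /expansion_coef /pFq_term !(big_cons, big_nil) !pochhammerE.
rewrite /connection_coef subn0 !rising0 bin0 muln0 !add0n fact0 !add0r !addr0 expr0.
have nfact : m`!%:R != 0 :> R[i] by rewrite pnatr_eq0 -lt0n fact_gt0.
by field; rewrite nfact !Re_gt0_rising0 // ?ReD_gt0.
Qed.

Lemma double_termS k m : (0 < k)%N -> double_term k m = expansion_coef k
  * pFq_term [:: d - h; 2 * k%:R + a + b + c + d - 1; k%:R + a + c; k%:R + b + c]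
      [:: k%:R + a + b + c + d - 1; 2 * k%:R + a + b + c + h; k%:R + c + d] rho m.
Proof.
move=> k_gt0.
rewrite /double_term /expansion_coef /pFq_term !(big_cons, big_nil) !pochhammerE.
rewrite /connection_coef addKn.
have nfact i : i`!%:R != 0 :> R[i] by rewrite pnatr_eq0 -lt0n fact_gt0.
have binE : 'C(k + m, k)%:R = (k + m)`!%:R / (k`!%:R * m`!%:R) :> R[i].
  by rewrite -(bin_fact (leq_addr m k)) addKn !natrM mulfK // mulf_neq0.
(* Both sides are the rising factorial of length k + m of k+a+b+c+d-1. *)
have shift : rising ((k + m)%:R + a + b + c + d - 1) k
      * rising (k%:R + a + b + c + d - 1) m
    = rising (k%:R + a + b + c + d - 1) k * rising (2 * k%:R + a + b + c + d - 1) m.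
  rewrite mulrC (_ : (k + m)%:R + a + b + c + d - 1
    = k%:R + a + b + c + d - 1 + m%:R); last by rewrite natrD; ring.
  rewrite (_ : 2 * k%:R + a + b + c + d - 1 = k%:R + a + b + c + d - 1 + k%:R);
    last by ring.
  by rewrite -!risingD addnC.
have sd0 : 0 < complex.Re (a + b + c + d) by rewrite !ReD_gt0.
(* Here k > 0 matters: a + b + c + d - 1 could be 0. *)
have sd_neq0 : rising (k%:R + a + b + c + d - 1) m != 0.
  case: k k_gt0 {shift binE} => // k _.
  rewrite (_ : _ - 1 = a + b + c + d + k%:R); first exact: Re_gt0_rising_neq0.
  by rewrite -natr1; ring.
have {}shift : rising ((k + m)%:R + a + b + c + d - 1) k
    = rising (k%:R + a + b + c + d - 1) k * rising (2 * k%:R + a + b + c + d - 1) m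
      / rising (k%:R + a + b + c + d - 1) m by rewrite -shift mulfK.
rewrite shift binE exprD (natrM _ 2 k) !risingD.
rewrite (_ : a + c + k%:R = k%:R + a + c); last by ring.
rewrite (_ : b + c + k%:R = k%:R + b + c); last by ring.
rewrite (_ : c + d + k%:R = k%:R + c + d); last by ring.
have ab0 : rising (a + b) k != 0 by rewrite Re_gt0_rising0 ?ReD_gt0.
have cd0 : rising (c + d) k != 0 by rewrite Re_gt0_rising0 ?ReD_gt0.
have abk0 : rising (a + b + k%:R) m != 0 by rewrite Re_gt0_rising_neq0 ?ReD_gt0.
have cdk0 : rising (k%:R + c + d) m != 0.
  rewrite (_ : k%:R + c + d = c + d + k%:R); last by ring.
  by rewrite Re_gt0_rising_neq0 ?ReD_gt0.
have sh0 := rising_abch_pred_neq0 abch_neq0 k.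
have sh1 := rising_abch_neq0 abch_neq0 (2 * k) m; rewrite natrM in sh1.
by field; rewrite !nfact ab0 cd0 abk0 cdk0 sh0 sh1 sd_neq0.
Qed.
End Terms.
End WilsonExpansion.

Unset Implicit Arguments.
Set Strict Implicit.

Theorem theorem11 (R : realType) (rho : R[i]) (x : R) (a b c d h : R[i])
  (rho_lt1 : `|rho| < 1) (x_gt0 : 0 < x)
  (Re_a : 0 < complex.Re a) (Re_b : 0 < complex.Re b)
  (Re_c : 0 < complex.Re c) (Re_d : 0 < complex.Re d)
  (Re_h : 0 < complex.Re h)
  (conj_pairs :
     perm_eq [seq z^* | z <- [:: a; b; c; d; h]] [:: a; b; c; d; h]) :
  series (fun k : nat =>
    pochhammer (k%:R + a + b + c + d - 1) k
    / (pochhammer (k%:R + a + b + c + h - 1) k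
       * pochhammer (a + b) k * pochhammer (c + d) k * k`!%:R)
    * (if k == 0%N
       then pFq [:: d - h; a + c; b + c] [:: a + b + c + h; c + d] rho
       else pFq [:: d - h; 2 * k%:R + a + b + c + d - 1;
                    k%:R + a + c; k%:R + b + c]
                [:: k%:R + a + b + c + d - 1; 2 * k%:R + a + b + c + h;
                    k%:R + c + d] rho)
    * rho ^+ k * wilson k x a b c h : R[i]^o) @ \oo -->
  (pFq [:: a + 'i%C * x%:C; b + 'i%C * x%:C] [:: a + b] rho
   * pFq [:: c - 'i%C * x%:C; d - 'i%C * x%:C] [:: c + d] rho : R[i]^o).
Proof.
set X := 'i%C * x%:C.
have [C [q [C0 q01 dt_le]]] :=
  double_term_bounded X Re_a Re_b Re_c Re_d Re_h rho_lt1.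
have [D [r [D0 r01 left_le right_le]]] :=
  left_right_term_bounded X Re_a Re_b Re_c Re_d rho_lt1.
have := cvg_cauchy_product D0 r01 left_le right_le.
under [fun n => \sum_(k < n.+1) _]eq_fun => n.
  rewrite -(sum_double_term rho X Re_a Re_b Re_c Re_d Re_h); over.
move=> /(cvg_interchange C0 q01 dt_le).
set rows := (fun k => limn _); set summands := (X in _ -> series X @ _ --> _).
suff -> : summands = rows by [].
rewrite /summands /rows {summands rows}; apply/funext => k.
have [->|k0] := eqVneq k 0%N.
  rewrite (row_sum Re_a Re_b Re_c Re_d Re_h rho_lt1
    (double_term0 rho X Re_a Re_b Re_c Re_d Re_h)).
  by rewrite /expansion_coef !pochhammerE wilsonE // /pFq; ring.
rewrite (row_sum Re_a Re_b Re_c Re_d Re_h rho_lt1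
  (fun m => double_termS rho X Re_a Re_b Re_c Re_d Re_h m _)) ?lt0n //.
by rewrite /expansion_coef !pochhammerE wilsonE // /pFq; ring.
Qed.
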